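(* Let $D$ be an integral domain and let $X$ be an indeterminate over $D$. Then $D$ is a super $v$-domain if and only if $D[X]$ is a super $v$-domain.
   Context: For an integral domain $R$ with quotient field $L$ and a nonzero fractional ideal $A$ of $R$, $A^{-1}=\{x\in L : xA\subseteq R\}$. $R$ is a $v$-domain if $(AA^{-1})^{-1}=R$ for every nonzero finitely generated ideal $A$ of $R$. $R$ is a super $v$-domain if every quotient ring of $R$, i.e. every ring of fractions $R_S$ with $S$ a multiplicative set of $R$ (not containing $0$), is a $v$-domain. *)

(* Defs.v *)
(* MathComp, with the Prop-valued sets of mathcomp-classical. *)
From HB Require Import structures.
From mathcomp Require Import all_boot all_order all_algebra.
From mathcomp Require Import boolp classical_sets.

Set Implicit Arguments.
Unset Strict Implicit.
Unset Printing Implicit Defensive.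

Import GRing.Theory.
Local Open Scope classical_set_scope.
Local Open Scope ring_scope.

(* A domain is represented here as a subring R of a field L that is its
   quotient field, so that the rings of fractions of a domain, which share its
   quotient field, are again of this form. *)
Section SubringsOfAField.
Variable L : fieldType.
Implicit Types (R A B : set L).

Definition is_subring R : Prop :=
  [/\ R 1, forall x y, R x -> R y -> R (x - y)
    & forall x y, R x -> R y -> R (x * y)].

Definition has_quotient_field R : Prop :=
  is_subring R /\
  forall x : L, exists a b, [/\ R a, R b, b != 0 & x = a / b].

Definition ideal_gen R n (g : 'I_n -> L) : set L :=
  [set x | exists r : 'I_n -> L,
     (forall i, R (r i)) /\ x = \sum_(i < n) r i * g i].

Definition is_fg_ideal R A : Prop :=
  exists n (g : 'I_n -> L), (forall i, R (g i)) /\ A = ideal_gen R g.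

Definition ideal_mul A B : set L :=
  [set x | exists n (a b : 'I_n -> L),
     [/\ forall i, A (a i), forall i, B (b i) & x = \sum_(i < n) a i * b i]].

Definition ideal_inv R A : set L :=
  [set x | forall a, A a -> R (x * a)].

Definition v_domain R : Prop :=
  forall A, is_fg_ideal R A -> A <> [set 0] ->
    ideal_inv R (ideal_mul A (ideal_inv R A)) = R.

End SubringsOfAField.

Definition multiplicative_set (R : idomainType) (S : set R) : Prop :=
  [/\ S 1, ~ S 0 & forall s t, S s -> S t -> S (s * t)].

Definition ring_of_fractions (R : idomainType) (S : set R) : set {fraction R} :=
  [set x | exists a s, S s /\ x = FracField.tofrac a / FracField.tofrac s].

Definition super_v_domain (R : idomainType) : Prop :=
  forall S : set R, multiplicative_set S -> v_domain (ring_of_fractions S).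

(* {fraction R} is indeed the quotient field of every ring of fractions of R,
   so v_domain is only used where it has its intended meaning. *)
Lemma ring_of_fractions_quotient_field (R : idomainType) (S : set R) :
  multiplicative_set S -> has_quotient_field (ring_of_fractions S).
Proof.
move=> [S1 S0 SM].
have Snz s : S s -> FracField.tofrac s != 0.
  by move=> Ss; rewrite tofrac_eq0; apply/eqP => s0; apply: S0; rewrite -s0.
split; first split.
- by exists 1, 1; split=> //; rewrite tofrac1 divr1.
- move=> _ _ [a [s [Ss ->]]] [b [t [St ->]]].
  exists (a * t - b * s), (s * t); split; first exact: SM.
  by rewrite -mulNr addf_div ?Snz // tofracB !tofracM mulNr.
- move=> _ _ [a [s [Ss ->]]] [b [t [St ->]]].
  exists (a * b), (s * t); split; first exact: SM.
  by rewrite mulf_div !tofracM.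
have Rin a : ring_of_fractions S (FracField.tofrac a).
  by exists a, 1; split=> //; rewrite tofrac1 divr1.
elim/quotW=> r.
exists (FracField.tofrac (frac r).1), (FracField.tofrac (frac r).2).
split=> //; first by rewrite tofrac_eq0 denom_ratioP.
rewrite -[X in X = _](mulfK (x := FracField.tofrac (frac r).2)) //.
  congr (_ / _); unlock FracField.tofrac; rewrite -[LHS]FracField.pi_mul.
  rewrite -[in LHS](Ratio_numden r) /FracField.mulf.
  rewrite !numden_Ratio ?oner_eq0 ?denom_ratioP // mulr1.
  apply/eqmodP; rewrite /= FracField.equivfE.
  by rewrite !numden_Ratio ?oner_eq0 ?denom_ratioP // mulr1 mulrC.
by rewrite tofrac_eq0 denom_ratioP.
Qed.

(* Main.v *)
Require Import Defs.
From mathcomp Require Import all_boot all_order all_algebra.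
From mathcomp Require Import boolp classical_sets ring.

(** Let K be the quotient field of D. That D is a super v-domain when D[X] is
    one is the easy half: a multiplicative set S of D is also one of D[X], with
    D[X]_S = D_S[X], and for a finitely generated ideal A of D_S the inverse of
    A[X] is A^-1[X]; the v-invertibility of A[X] is thus that of A.

    For the other half, let S be a multiplicative set of D[X] and A a nonzero
    finitely generated ideal of D[X]_S. Dividing its generators by their
    greatest common divisor in K[X] (primitive_factorization), one may assume
    that A contains a nonzero constant d. If x (A A^-1) is contained in D[X]_S,
    then x is m / d up to a unit, with m in D[X], so the question is about
    coefficients. The ideal J of the constants j such that j m / d is in D[X]
    is to be confronted with S. If some s in S has all its coefficients in J,
    then s m / d is in D[X] and x is in D[X]_S. Otherwise there is a prime P
    of D containing J such that every s in S has a coefficient outside P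
    (exists_prime_avoiding). By hypothesis D_P is a v-domain, hence obeys
    Gauss's lemma (v_domain_gauss): if f g has coefficients in D_P, so have
    all the products of a coefficient of f and one of g. Applied to s and an
    element of K[X], it shows that the denominators in S do no more than those
    in D \ P: an element y of K[X] with s y in D_P[X] is itself in D_P[X].
    Applied again to m, it turns the hypothesis on x into the statement that
    each coefficient of m / d multiplies C C^-1 into D_P, C being the ideal
    generated by the coefficients of the generators of A. As C is v-invertible,
    m / d is in D_P[X], which gives an element of J outside P: a contradiction.

    No quotient field of D, nor of D[X], has to be embedded in another: every
    membership of a fraction x / w in a ring of fractions R_S is written as the
    divisibility of x by w up to a factor in S, and v_domainP restates the
    v-domain property in these terms. *)

Set Implicit Arguments.
Unset Strict Implicit.
Unset Printing Implicit Defensive.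

Import GRing.Theory.
Local Open Scope classical_set_scope.
Local Open Scope ring_scope.

(** * Divisibility up to a factor in a multiplicative set *)

Definition is_ideal (R : idomainType) (J : set R) :=
  J 0 /\ forall r x y, J x -> J y -> J (r * x + y).

(** This is the condition that x / w belong to R_S, freed of fractions. *)
Definition locdvd (R : idomainType) (S : set R) (w x : R) :=
  exists t r, S t /\ t * x = w * r.

(** For the ideal A generated by the list a, a fraction u / w lies in the
    inverse of A when w divides all the u * x, and the products x * (u / w)
    generate A A^-1: the condition says that a fraction p / q which multiplies
    all of these into R_S is itself in R_S. *)
Definition elementwise_v_domain (R : idomainType) (S : set R) :=
  forall (a : seq R) p q, has (fun x => x != 0) a -> q != 0 ->
    (forall u w, w != 0 -> (forall x, x \in a -> locdvd S w (u * x)) ->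
       forall x, x \in a -> locdvd S (q * w) (p * (u * x))) ->
  locdvd S q p.

Section LocalDivisibility.
Variables (R : idomainType) (S : set R).
Hypothesis mS : multiplicative_set S.
Implicit Types (p q r s t u w x y : R).

Lemma locdvd0 w : locdvd S w 0.
Proof. by case: mS => S1 _ _; exists 1, 0; rewrite !mulr0. Qed.

Lemma dvd_locdvd w x y : x = w * y -> locdvd S w x.
Proof. by case: mS => S1 _ _ ->; exists 1, y; rewrite mul1r. Qed.

Lemma locdvdD w x y : locdvd S w x -> locdvd S w y -> locdvd S w (x + y).
Proof.
case: mS => _ _ SM [s [a [Ss xE]]] [t [b [St yE]]].
exists (s * t), (t * a + s * b); split; first exact: SM.
transitivity (t * (s * x) + s * (t * y)); first by ring.
by rewrite xE yE; ring.
Qed.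

Lemma locdvd_mull w x y : locdvd S w x -> locdvd S w (y * x).
Proof.
by move=> [t [r [St xE]]]; exists t, (y * r); rewrite mulrCA xE mulrCA.
Qed.

Lemma locdvdB w x y : locdvd S w x -> locdvd S w y -> locdvd S w (x - y).
Proof.
by move=> wx wy; apply: locdvdD => //; rewrite -mulN1r; apply: locdvd_mull.
Qed.

Lemma locdvd_sum (I : Type) (r : seq I) (P : pred I) (F : I -> R) w :
  (forall i, P i -> locdvd S w (F i)) -> locdvd S w (\sum_(i <- r | P i) F i).
Proof.
move=> wF; elim/big_ind: _ => //; first exact: locdvd0.
by move=> x y wx wy; exact: locdvdD.
Qed.

Lemma locdvdM v w x y :
  locdvd S v x -> locdvd S w y -> locdvd S (v * w) (x * y).
Proof.
case: mS => _ _ SM [s [a [Ss xE]]] [t [b [St yE]]].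
by exists (s * t), (a * b); split; [exact: SM | rewrite mulrACA xE yE mulrACA].
Qed.

Lemma locdvd_unit t w x : S t -> locdvd S w (t * x) -> locdvd S w x.
Proof.
case: mS => _ _ SM St [s [r [Ss xE]]].
by exists (s * t), r; split; [exact: SM | rewrite -mulrA].
Qed.

(** Fractions that agree by cross-multiplication are interchangeable; this is
    the form in which all fractions are simplified below. *)
Lemma locdvd_cross q p q' p' :
  q != 0 -> p * q' = p' * q -> locdvd S q p -> locdvd S q' p'.
Proof.
move=> q0 E [t [r [St pE]]]; exists t, r; split=> //.
apply: (mulIf q0); rewrite -mulrA -E mulrA pE; ring.
Qed.

(** A common denominator for finitely many elements. *)
Lemma multiplicative_set_common (I : eqType) (xs : seq I) (P : I -> set R) :
  (forall i s t, P i s -> P i (s * t)) ->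
  (forall i, i \in xs -> exists2 t, S t & P i t) ->
  exists2 t, S t & forall i, i \in xs -> P i t.
Proof.
case: mS => S1 _ SM PM; elim: xs => [|i xs IH] Pxs; first by exists 1.
have [|t St Pt] := IH; first by move=> j jxs; apply: Pxs; rewrite inE jxs orbT.
have [|s Ss Ps] := Pxs i; first by rewrite mem_head.
exists (s * t); first exact: SM.
move=> j; rewrite inE => /predU1P[->|/Pt Pj]; first exact: PM.
by rewrite mulrC; apply: PM.
Qed.

(** * The v-domain property without fractions *)

Local Notation tofrac := (@FracField.tofrac R).
Local Notation RS := (ring_of_fractions S).

Lemma tofrac_neq0 x : x != 0 -> tofrac x != 0.
Proof. by rewrite tofrac_eq0. Qed.

Lemma multiplicative_set_neq0 s : S s -> s != 0.
Proof. by case: mS => _ S0 _ Ss; apply/eqP => s0; apply: S0; rewrite -s0. Qed.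

Lemma fracP (z : {fraction R}) :
  exists p q, q != 0 /\ z = tofrac p / tofrac q.
Proof.
have m1 : multiplicative_set [set s : R | s = 1].
  split=> //=; first by move/eqP; rewrite eq_sym oner_eq0.
  by move=> s t -> ->; rewrite mulr1.
have [_ /(_ z) [_ [_ [[p [_ [-> ->]]] [q [_ [-> ->]]] + ->]]]] :=
  ring_of_fractions_quotient_field m1.
by rewrite tofrac1 !divr1 tofrac_eq0 => q0; exists p, q.
Qed.

Lemma ring_of_fractionsE p q :
  q != 0 -> RS (tofrac p / tofrac q) <-> locdvd S q p.
Proof.
move=> q0; split=> [[a [s [Ss E]]]|[t [r [St E]]]].
  have s0 := multiplicative_set_neq0 Ss.
  exists s, a; split=> //; apply/eqP; rewrite -tofrac_eq !tofracM; apply/eqP.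
  apply: (mulIf (invr_neq0 (tofrac_neq0 q0))); rewrite -mulrA E.
  rewrite [RHS]mulrAC divff ?tofrac_neq0 // mul1r mulrCA.
  by rewrite divff ?tofrac_neq0 ?mulr1.
have t0 := multiplicative_set_neq0 St.
exists r, t; split=> //; apply/eqP; rewrite eqr_div ?tofrac_neq0 //.
by rewrite -!tofracM tofrac_eq mulrC E mulrC.
Qed.

Lemma tofrac_ring_of_fractions x : RS (tofrac x).
Proof. by case: mS => S1 _ _; exists x, 1; rewrite tofrac1 divr1. Qed.

Lemma ring_of_fractionsM (x y : {fraction R}) : RS x -> RS y -> RS (x * y).
Proof. by have [[_ _ +] _] := ring_of_fractions_quotient_field mS; apply. Qed.

Lemma ring_of_fractions_sum n (F : 'I_n -> {fraction R}) :
  (forall i, RS (F i)) -> RS (\sum_i F i).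
Proof.
have [[R1 RBB _] _] := ring_of_fractions_quotient_field mS.
have RB (x y : {fraction R}) : RS x -> RS y -> RS (x - y) by exact: RBB.
have R0 : RS 0 by rewrite -(subrr 1); exact: RB.
have RD (x y : {fraction R}) : RS x -> RS y -> RS (x + y).
  by move=> Rx Ry; rewrite -(opprK y) -[- y]sub0r; apply: (RB) => //; exact: RB.
by move=> RF; elim/big_ind: _.
Qed.

(** Generators of an ideal of R_S differ from elements of R by units, so it is
    enough to consider ideals generated by finitely many elements of R. *)
Lemma v_domainP : v_domain RS <-> elementwise_v_domain S.
Proof.
split=> [vRS a p q /hasP[x0 ax0 x0n] q0 H | vS A [n [g [Rg AE]]] A0].
  pose gA (i : 'I_(size a)) := tofrac a`_i.
  have memA x : x \in a -> ideal_gen RS gA (tofrac x).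
    move=> xa; have xi : (index x a < size a)%N by rewrite index_mem.
    exists (fun i => (i == Ordinal xi)%:R); split.
      move=> i; rewrite -(rmorph_nat tofrac).
      exact: tofrac_ring_of_fractions.
    rewrite (bigD1 (Ordinal xi)) //= eqxx mul1r /gA nth_index // big1 ?addr0 //.
    by move=> i /negPf ->; rewrite mul0r.
  have fgA : is_fg_ideal RS (ideal_gen RS gA).
    by exists (size a), gA; split=> // i; exact: tofrac_ring_of_fractions.
  have /(vRS _ fgA) invE : ideal_gen RS gA <> [set 0].
    move=> A0; have := memA _ ax0; rewrite A0 /= => /eqP.
    by rewrite tofrac_eq0 (negPf x0n).
  apply/ring_of_fractionsE=> //; rewrite -invE => _ [n [al [be [Aal Abe ->]]]].
  rewrite mulr_sumr; apply: ring_of_fractions_sum => i.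
  have {Aal} [r [Rr ->]] := Aal i; have {Abe} := Abe i.
  have [u [w [w0 ->]]] := fracP (be i) => bA.
  rewrite mulr_suml mulr_sumr; apply: ring_of_fractions_sum => j.
  rewrite -mulrA mulrCA; apply: ring_of_fractionsM => //.
  have -> : tofrac p / tofrac q * (gA j * (tofrac u / tofrac w)) =
      tofrac (p * (u * a`_j)) / tofrac (q * w).
    by rewrite !tofracM invfM; ring.
  apply/ring_of_fractionsE; rewrite ?mulf_neq0 //.
  apply: H => //; last exact: mem_nth.
  move=> x /memA /bA; rewrite mulrAC -tofracM.
  by move/(ring_of_fractionsE _ w0).
apply/seteqP; split=> [y yI | y Ry _ [m [al [be [Aal Abe ->]]]]]; last first.
  apply: ring_of_fractionsM => //; apply: ring_of_fractions_sum => i.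
  by rewrite mulrC; apply: Abe.
have /choice [num numP] i :
    exists c, exists2 s, S s & g i = tofrac c / tofrac s.
  by have [c [s [Ss ->]]] := Rg i; exists c, s.
have Anum i : A (tofrac (num i)).
  have [s Ss gE] := numP i; rewrite AE.
  exists (fun j => if j == i then tofrac s else 0); split.
    move=> j; case: eqP => _; first exact: tofrac_ring_of_fractions.
    by rewrite -(tofrac0 R); exact: tofrac_ring_of_fractions.
  rewrite (bigD1 i) //= eqxx big1 ?addr0; last first.
    by move=> j /negPf ->; rewrite mul0r.
  by rewrite gE mulrCA divff ?mulr1 // tofrac_neq0 // multiplicative_set_neq0.
have [p [q [q0 yE]]] := fracP y; rewrite yE; apply/ring_of_fractionsE => //.
apply: (vS (codom num)) => //.
  apply: contra_notT A0; rewrite -all_predC => /allP num0.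
  have g0 i : g i = 0.
    have [s _ ->] := numP i; have := num0 _ (codom_f num i).
    by rewrite /= negbK => /eqP ->; rewrite tofrac0 mul0r.
  rewrite AE; apply/seteqP; split=> [_ [r [_ ->]] | _ ->] /=.
    by rewrite big1 // => i _; rewrite g0 mulr0.
  exists (fun=> 0); split=> [i|].
    by rewrite -(tofrac0 R); exact: tofrac_ring_of_fractions.
  by rewrite big1 // => i _; rewrite mul0r.
move=> u w w0 uw _ /codomP[i ->].
apply/ring_of_fractionsE; first by rewrite mulf_neq0.
have -> : tofrac (p * (u * num i)) / tofrac (q * w) =
    y * (tofrac (num i) * (tofrac u / tofrac w)).
  by rewrite yE !tofracM invfM; ring.
apply: yI; exists 1%N, (fun=> tofrac (num i)), (fun=> tofrac u / tofrac w).
rewrite big_ord1; split=> // _ z; rewrite AE => -[r [Rr ->]] {z}.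
rewrite mulr_sumr; apply: ring_of_fractions_sum => j.
rewrite mulrCA; apply: ring_of_fractionsM => //; have [s Ss ->] := numP j.
rewrite mulrA; apply: ring_of_fractionsM; last first.
  by exists 1, s; rewrite tofrac1 div1r.
rewrite mulrAC -tofracM; apply/ring_of_fractionsE => //.
exact: uw (codom_f _ _).
Qed.

End LocalDivisibility.

(** * Gauss's lemma *)

Section Polynomials.
Variable D : idomainType.
Implicit Types (S T J : set D) (f g h : {poly D}) (d w : D).

Lemma multiplicative_set_polyC T :
  multiplicative_set T -> multiplicative_set (polyC @` T).
Proof.
move=> [T1 T0 TM]; split; first by exists 1.
  by move=> [t Tt /eqP]; rewrite polyC_eq0 => /eqP t0; apply: T0; rewrite -t0.
by move=> _ _ [s Ts <-] [t Tt <-]; exists (s * t); [exact: TM | rewrite polyCM].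
Qed.

(** This is the equality D[X]_T = D_T[X], for T in D. *)
Lemma locdvd_polyC T w f : multiplicative_set T ->
  locdvd (polyC @` T) w%:P f <-> forall i, locdvd T w f`_i.
Proof.
move=> mT; split=> [[_ [r [[t Tt <-] E]]] i | ].
  by exists t, r`_i; split=> //; rewrite -!coefCM E.
elim/poly_ind: f => [|f c IH] wf; first exact/locdvd0/multiplicative_set_polyC.
apply: locdvdD; first exact: multiplicative_set_polyC.
  rewrite mulrC; apply: locdvd_mull; apply: IH => i.
  by have := wf i.+1; rewrite coefD coefMX coefC addr0.
have [t [r [Tt E]]] := wf 0%N; exists t%:P, r%:P; split; first by exists t.
by rewrite -!polyCM -E coefD coefMX coefC add0r.
Qed.

(** The ideal A generated by the coefficients of f is v-invertible, and the
    lemma says that g / w multiplies A into D_T. The argument is the one by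
    which McCoy finds constant annihilators of zero divisors, by induction on
    the degree of g. Suppose that the coefficients of f after the i-th multiply
    g / w into D_T. Then so does the i-th with the leading coefficient of g.
    Without its leading term, f_i g / w is of smaller degree, and its product
    with f has coefficients in A; multiplied by any element u / v of A^-1 it
    falls under the induction hypothesis. Its coefficients therefore multiply
    A A^-1 into D_T, hence belong to D_T. *)
Lemma v_domain_gauss T : multiplicative_set T -> elementwise_v_domain T ->
  forall f g w, w != 0 -> (forall k, locdvd T w (f * g)`_k) ->
  forall i j, locdvd T w (f`_i * g`_j).
Proof.
move=> mT vT f g w; move: {2}(size g) (leqnn (size g)) => n.
elim: n => [|n IHn] in g w *.
  rewrite leqn0 size_poly_eq0 => /eqP -> _ _ i j.
  by rewrite coef0 mulr0; exact: locdvd0.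
move=> gn w0 wfg; have [->|f0] := eqVneq f 0.
  by move=> i j; rewrite coef0 mul0r; exact: locdvd0.
suff H m : forall i, (size f <= i + m)%N -> forall j, locdvd T w (f`_i * g`_j).
  by move=> i; apply: (H (size f)); rewrite leq_addl.
elim: m => [|m IHm] i im j.
  by rewrite addn0 in im; rewrite nth_default ?mul0r //; exact: locdvd0.
(* The leading term of g, seen in the coefficient i + n of f * g. *)
have top : locdvd T w (f`_i * g`_n).
  have := wfg (i + n)%N; rewrite coefM.
  have ii : (i < (i + n).+1)%N by rewrite ltnS leq_addr.
  rewrite (bigD1 (Ordinal ii)) //= addKn => /locdvdB => /(_ mT _).
  move=> /(_ (\sum_(k < (i + n).+1 | k != Ordinal ii) f`_k * g`_(i + n - k))).
  rewrite addrK; apply; apply: locdvd_sum => // k; rewrite -val_eqE /= => ki.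
  case: (ltngtP k i) ki => // ki _.
    rewrite [X in _ * X]nth_default ?mulr0; first exact: locdvd0.
    by apply: (leq_trans gn); rewrite ltn_subRL ltn_add2r.
  by apply: IHm; apply: (leq_trans im); rewrite addnS -addSn leq_add2r.
case: (ltngtP j n) => [jn|nj|-> //]; last first.
  by rewrite [X in _ * X]nth_default ?mulr0 ?(leq_trans gn) //; exact: locdvd0.
(* v-invertibility of the content of f, for f`_i * g`_j / w. *)
apply: (vT f) => //.
  apply/hasP; exists (lead_coef f); last by rewrite lead_coef_eq0.
  by rewrite mem_nth // prednK // size_poly_gt0.
move=> u v v0 vuf x /(nthP 0) [l _ <-].
have {}vuf k : locdvd T v (u * f`_k).
  have [kf|kf] := ltnP k (size f); first exact/vuf/mem_nth.
  by rewrite nth_default // mulr0; exact: locdvd0.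
have := IHn ((u * f`_i) *: take_poly n g) (w * v).
rewrite (leq_trans (size_scale_leq _ _) (size_take_poly _ _)) mulf_neq0 //.
move=> /(_ isT isT _ l j); rewrite coefZ coef_take_poly jn.
rewrite (_ : f`_l * _ = f`_i * g`_j * (u * f`_l)); last by ring.
apply=> k.
have gE : take_poly n g = g - g`_n *: 'X^n.
  apply/polyP=> e; rewrite coef_take_poly coefB coefZ coefXn.
  case: (ltngtP e n) => [_|ne|->]; rewrite ?mulr0 ?mulr1 ?subr0 ?subrr //.
  by rewrite nth_default // (leq_trans gn).
have -> : f * ((u * f`_i) *: take_poly n g) =
    (u * f`_i) *: (f * g) - (u * f`_i * g`_n) *: (f * 'X^n).
  by rewrite gE -!mul_polyC !polyCM; ring.
rewrite coefB !coefZ coefMXn; apply: locdvdB => //.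
  by rewrite mulrC; apply: locdvdM.
case: ifP => _; first by rewrite mulr0; exact: locdvd0.
have -> : u * f`_i * g`_n * f`_(k - n) = f`_i * g`_n * (u * f`_(k - n)).
  by ring.
exact: locdvdM.
Qed.

(** * Primes avoided by polynomials *)

Lemma ideal_sum J n (F : 'I_n -> D) :
  is_ideal J -> (forall i, J (F i)) -> J (\sum_i F i).
Proof.
move=> [J0 JD] JF; elim/big_ind: _ => // x y Jx Jy.
by rewrite -(mul1r x); exact: JD.
Qed.

(** The set T is the complement of a prime P, maximal among the ideals that
    contain J and do not contain all the coefficients of an element of S. If a
    and b are outside P, there are s and t in S with coefficients in P + a D
    and P + b D; were a * b in P, all coefficients of s * t would be in P. *)
Lemma exists_prime_avoiding (S : set {poly D}) J :
  multiplicative_set S -> is_ideal J ->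
  (forall s, S s -> exists i, ~ J s`_i) ->
  exists T, [/\ multiplicative_set T, forall x, J x -> ~ T x
    & forall s, S s -> exists i, T s`_i].
Proof.
move=> [S1 S0 SM] idJ SJ.
pose good Q := [/\ is_ideal Q, J `<=` Q & forall s, S s -> exists i, ~ Q s`_i].
(* The empty set is admitted because it is the union of the empty chain. *)
have [|P [goodP maxP]] := @Zorn_bigcup D [set Q | Q = set0 \/ good Q].
  move=> F Fgood Ftot /=.
  have [[Q1 FQ1 Q1n]|Fn] := pselect (exists2 Q, F Q & Q <> set0); last first.
    left; apply/seteqP; split=> // x [Q FQ Qx]; case: Fn; exists Q => // Q0.
    by rewrite Q0 in Qx.
  have Fg Q x : F Q -> Q x -> good Q.
    by move=> FQ Qx; case: (Fgood _ FQ) => // Q0; rewrite Q0 in Qx.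
  have [//|[[Q10 _] JQ1 SQ1]] := Fgood _ FQ1.
  right; split.
  - split=> [|r x y [Q FQ Qx] [Q' FQ' Q'y]]; first by exists Q1.
    have [[_ QD] _ _] := Fg _ _ FQ Qx; have [[_ Q'D] _ _] := Fg _ _ FQ' Q'y.
    case: (Ftot _ _ FQ FQ') => [/(_ _ Qx)|/(_ _ Q'y)] ?.
      by exists Q' => //; exact: Q'D.
    by exists Q => //; exact: QD.
  - by move=> x Jx; exists Q1 => //; exact: JQ1.
  move=> s Ss; apply: contrapT => /forallNP sF.
  have {}sF i : (\bigcup_(X in F) X) s`_i by apply: contrapT; exact: sF.
  (* A polynomial has finitely many coefficients, so one member of the chain
     contains them all. *)
  have [Q FQ Qs] : exists2 Q, F Q & forall i, (i < size s)%N -> Q s`_i.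
    elim: (size s) => [|k [Q FQ Qs]]; first by exists Q1.
    have [Q' FQ' Q's] := sF k.
    have [QQ'|Q'Q] := Ftot _ _ FQ FQ'.
      exists Q' => // i; rewrite ltnS leq_eqVlt => /predU1P[->//|/Qs].
      exact: QQ'.
    exists Q => // i; rewrite ltnS leq_eqVlt => /predU1P[->|/Qs//].
    exact: Q'Q.
  have s_gt0 : (0 < size s)%N.
    by rewrite size_poly_gt0; apply/eqP => s0; apply: S0; rewrite -s0.
  have [[Q0 _] _ /(_ s Ss) [i]] := Fg _ _ FQ (Qs _ s_gt0); apply.
  by have [/Qs//|si] := ltnP i (size s); rewrite nth_default.
have {goodP} [[P0 PD] JP SP] : good P.
  case: goodP => // PE; case: (maxP J); last by right; split.
  rewrite PE; split=> // /(_ 0); case: idJ => J0 _; exact.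
have PM r x : P x -> P (r * x) by move=> Px; rewrite -[_ * _]addr0; exact: PD.
(* Maximality of P, applied to the ideal P + a D. *)
have grow a : ~ P a ->
    exists2 s, S s & forall i, exists p c, P p /\ s`_i = p + a * c.
  move=> Pa; apply: contrapT => noS.
  apply: (maxP [set x | exists p c, P p /\ x = p + a * c]).
    split=> [|PP]; first by move=> x Px; exists x, 0; rewrite mulr0 addr0.
    by apply/Pa/PP; exists 0, 1; rewrite mulr1 add0r.
  right; split.
  - split; first by exists 0, 0; rewrite mulr0 addr0.
    move=> r _ _ [p [c [Pp ->]]] [p' [c' [Pp' ->]]].
    by exists (r * p + p'), (r * c + c'); split; [exact: PD | ring].
  - by move=> x /JP Px; exists x, 0; rewrite mulr0 addr0.
  move=> s Ss; apply: contrapT => /forallNP sN; apply: noS; exists s => // i.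
  exact: contrapT (sN i).
exists (~` P); split.
- split.
  + move=> P1; have [i] := SP 1 S1; apply.
    by rewrite -(mulr1 (1 : {poly D})`_i); apply: PM.
  + by apply.
  move=> a b /grow[s Ss sE] /grow[t St tE] Pab.
  have [k] := SP _ (SM _ _ Ss St); apply.
  rewrite coefM; apply: ideal_sum => // i.
  have [p [c [Pp ->]]] := sE i; have [q [e [Pq ->]]] := tE (k - i)%N.
  have -> : (p + a * c) * (q + b * e) =
      (q + b * e) * p + (a * c * q + c * e * (a * b)) by ring.
  by apply: (PD) => //; apply: PD => //; exact: PM.
- by move=> x Jx; apply; exact: JP.
- exact: SP.
Qed.

(** * Generators without a common factor *)

(** Over the quotient field of D, h is the greatest common divisor of a and
    the g x are the cofactors, up to the constant d that clears denominators.
    A nonzero combination of the elements of a, of minimal degree, serves as h: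
    all of them are divisible by h after multiplication by a power of its
    leading coefficient. Since h is itself a combination of the x, dividing by
    h the corresponding combination of the d * x = h * g x gives d as a
    combination of the g x. *)
Lemma primitive_factorization (a : seq {poly D}) : has (fun x => x != 0) a ->
  exists h d (g : {poly D} -> {poly D}),
    [/\ h != 0, d != 0, forall x, x \in a -> d%:P * x = h * g x
      & forall K : set {poly D}, is_ideal K ->
          (forall x, x \in a -> K (g x)) -> K d%:P].
Proof.
move=> /hasP[x0 ax0 x0n].
(* I is the ideal generated by a. *)
pose I f := forall Q : set {poly D},
  is_ideal Q -> (forall x, x \in a -> Q x) -> Q f.
have Ia x : x \in a -> I x by move=> xa Q _; apply.
have : exists n, `[< exists f, [/\ I f, f != 0 & size f = n] >].
  by exists (size x0); apply/asboolP; exists x0; split=> //; exact: Ia.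
move=> exn; case: (ex_minnP exn) => n /asboolP[h [Ih h0 <-]] hmin.
have modh x : x \in a -> x %% h = 0.
  move=> xa; apply/eqP; apply: contraTT isT => r0.
  have := Pdiv.Idomain.ltn_modp x h; rewrite h0 ltnNge hmin //.
  apply/asboolP; exists (x %% h); split=> // Q iQ Qa; have [_ QD] := iQ.
  have -> : x %% h = - (x %/ h) * h + (lead_coef h ^+ scalp x h *: x).
    by rewrite Pdiv.Idomain.divp_eq; ring.
  apply: (QD); first exact: Ih.
  by rewrite -mul_polyC -[_ * _]addr0; apply: QD; [exact: Qa | case: iQ].
pose N := \max_(x <- a) scalp x h.
pose g x := lead_coef h ^+ (N - scalp x h) *: (x %/ h).
exists h, (lead_coef h ^+ N), g.
have E x : x \in a -> (lead_coef h ^+ N)%:P * x = h * g x.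
  rewrite /g => xa; have le : (scalp x h <= N)%N by exact: leq_bigmax_seq.
  rewrite -{1}(subnK le) exprD polyCM -mulrA mul_polyC mul_polyC.
  by rewrite Pdiv.Idomain.divp_eq modh // addr0 -scalerAr [h * _]mulrC.
split=> //; first by rewrite expf_neq0 // lead_coef_eq0.
move=> K [K0 KD] Kg.
have [||m [/(mulIf h0) ->//]] :=
  Ih (fun f => exists m, (lead_coef h ^+ N)%:P * f = m * h /\ K m).
- split; first by exists 0; rewrite mulr0 mul0r.
  move=> r x y [m [mE Km]] [m' [m'E Km']]; exists (r * m + m').
  by split; [rewrite mulrDr mulrCA mE m'E; ring | exact: KD].
- by move=> x xa; exists (g x); split; [rewrite E // mulrC | exact: Kg].
Qed.

(** * The two implications *)

(** If u / w multiplies the constants a into D[X]_S = D_S[X], then, x0 being a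
    nonzero element of a, u / w is n / (t * x0) for some t in S and some
    polynomial n; the coefficients of this fraction multiply a into D_S. *)
Lemma super_v_domain_polyW : super_v_domain {poly D} -> super_v_domain D.
Proof.
move=> vDX S mS; have mSX := multiplicative_set_polyC mS.
apply/(v_domainP mS) => a p q a0 q0 H.
have /(v_domainP mSX) {}vDX := vDX _ mSX.
suff /(locdvd_polyC _ _ mS)/(_ 0%N) : locdvd (polyC @` S) q%:P p%:P.
  by rewrite !coefC.
apply: (vDX (map polyC a)); rewrite ?polyC_eq0 //.
  by rewrite has_map; apply: sub_has a0 => x /=; rewrite polyC_eq0.
have [x0 ax0 x0n] := hasP a0.
move=> u w w0 uw _ /mapP[x xa ->].
have [_ [n [[t St <-] nE]]] := uw _ (map_f polyC ax0).
have t0 := multiplicative_set_neq0 mS St.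
suff : locdvd (polyC @` S) (q * (t * x0))%:P (p%:P * (n * x%:P)).
  apply: locdvd_cross; first by rewrite polyC_eq0 !mulf_neq0.
  rewrite !polyCM.
  transitivity (p%:P * x%:P * q%:P * (w * n)); first by ring.
  by rewrite -nE; ring.
apply/locdvd_polyC => // i; rewrite coefCM coefMC.
apply: H => // [|y ya]; first by rewrite mulf_neq0.
rewrite -coefMC; move: i; apply/(locdvd_polyC _ _ mS).
apply: locdvd_cross (uw _ (map_f polyC ya)) => //.
rewrite !polyCM; transitivity (y%:P * (t%:P * (u * x0%:P))); first by ring.
by rewrite nE; ring.
Qed.

(** The fraction p / q is successively replaced by m / d, with m a polynomial,
    and by the coefficients of m / d, while the ideal generated by a is replaced
    by that generated by the g x, and by the coefficients of the g x. *)
Lemma super_v_domain_poly : super_v_domain D -> super_v_domain {poly D}.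
Proof.
move=> vD S mS; apply/(v_domainP mS) => a p q a0 q0 H.
have [h [d [g [h0 d0 gE gd]]]] := primitive_factorization a0.
have dP0 : d%:P != 0 :> {poly D} by rewrite polyC_eq0.
(* Multiplying all generators by d / h does not affect v-invertibility. *)
have Hg (u w : {poly D}) :
    w != 0 -> (forall x, x \in a -> locdvd S w (u * g x)) ->
    forall x, x \in a -> locdvd S (q * w) (p * (u * g x)).
  move=> w0 uw x xa.
  have := H (u * d%:P) (w * h); rewrite mulf_neq0 // => /(_ isT _ x xa).
  rewrite -[u * _ * x]mulrA gE // => HH; apply: locdvd_cross (HH _).
  - by rewrite !mulf_neq0.
  - ring.
  move=> y ya; rewrite -mulrA gE //; apply: locdvd_cross (uw y ya) => //; ring.
(* As p / q multiplies the g x into D[X]_S, it does so with d, which is a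
   combination of them. *)
have [s0 [m [Ss0 mE]]] : locdvd S q (p * d%:P).
  have [S1 _ _] := mS.
  apply: (gd (fun f => locdvd S q (p * f))).
    split; first by rewrite mulr0; exact: locdvd0.
    move=> r x y qx qy; rewrite mulrDr mulrCA; apply: locdvdD => //.
    exact: locdvd_mull.
  move=> x xa; rewrite -(mulr1 q) -(mul1r (g x)); apply: Hg => //.
    exact: oner_neq0.
  by move=> y ya; apply: (dvd_locdvd mS (y := g y)).
have {H}Hm (u w : {poly D}) :
    w != 0 -> (forall x, x \in a -> locdvd S w (u * g x)) ->
    forall x, x \in a -> locdvd S (d%:P * w) (m * (u * g x)).
  move=> w0 uw x xa.
  apply: locdvd_cross (locdvd_mull s0 (Hg u w w0 uw x xa)).
    by rewrite mulf_neq0.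
  transitivity (s0 * (p * d%:P) * (u * g x * w)); first by ring.
  by rewrite mE; ring.
suff dm : locdvd S d%:P m.
  apply: (locdvd_unit mS Ss0); apply: locdvd_cross dm => //.
  by rewrite mulrC -mE mulrA.
pose J : set D := [set j | exists r, j%:P * m = d%:P * r].
have idJ : is_ideal J.
  split; first by exists 0; rewrite mul0r mulr0.
  move=> r x y [b bE] [c cE]; exists (r%:P * b + c).
  by rewrite polyCD polyCM mulrDl -mulrA bE cE; ring.
have [[s Ss sJ]|SJ] := pselect (exists2 s, S s & forall i, J s`_i).
  have [r rE] : exists r, s * m = d%:P * r.
    elim/poly_ind: s sJ {Ss} => [|s c IH] sJ.
      by exists 0; rewrite mul0r mulr0.
    have [|b bE] := IH.
      by move=> i; have := sJ i.+1; rewrite coefD coefMX coefC addr0.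
    have [c' cE] := sJ 0%N; move: cE; rewrite coefD coefMX coefC add0r => cE.
    by exists (b * 'X + c'); rewrite mulrDl cE mulrAC bE; ring.
  by exists s, r.
have [|T [mT JT ST]] := exists_prime_avoiding mS idJ.
  move=> s Ss; apply: contrapT => /forallNP sJ; apply: SJ; exists s => // i.
  exact: contrapT (sJ i).
have /(v_domainP mT) vT := vD _ mT.
suff /(locdvd_polyC _ _ mT)[_ [r [[t Tt <-] tE]]] : forall i, locdvd T d m`_i.
  by case: (JT t) => //; exists r.
move=> i; apply: (vT (flatten [seq (g x : seq D) | x <- a])) => //.
  apply/hasP; apply: contrapT => g0; have /negP := d0; apply.
  rewrite -(polyC_eq0 d); apply/eqP.
  apply: (gd [set 0]); first by split=> //= r x y -> ->; rewrite mulr0 addr0.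
  move=> x xa /=; apply/eqP; apply: contrapT => /negP gx; apply: g0.
  exists (lead_coef (g x)); last by rewrite lead_coef_eq0.
  apply/flattenP; exists (g x : seq D); first exact: map_f.
  by rewrite mem_nth // prednK // size_poly_gt0.
(* Let u / w multiply all coefficients of the g x into D_T. A common
   denominator t makes t * u / w an element of the inverse of the ideal
   generated by the g x over D[X]_S. *)
move=> u w w0 uw _ /flattenP[_ /mapP[x xa ->]] /(nthP 0)[j _ <-].
have [t Tt tw] : exists2 t, T t & forall y, y \in a ->
    exists r, t%:P * (u%:P * g y) = w%:P * r.
  apply: (multiplicative_set_common mT) => [y b c [r rE]|y ya].
    by exists (c%:P * r); rewrite polyCM -mulrA mulrCA rE mulrCA.
  have [|_ [r [[t Tt <-] tE]]] := (locdvd_polyC w (u%:P * g y) mT).2.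
    move=> k; rewrite coefCM; have [kg|kg] := ltnP k (size (g y)); last first.
      by rewrite nth_default // mulr0; exact: locdvd0.
    apply: uw; apply/flattenP; exists (g y : seq D); first exact: map_f.
    exact: mem_nth.
  by exists t => //; exists r.
have [||s [n [Ss sE]]] := Hm (t%:P * u%:P) w%:P _ _ x xa.
- by rewrite polyC_eq0.
- move=> y ya; have [r rE] := tw y ya.
  by apply: (dvd_locdvd mS (y := r)); rewrite -mulrA.
have dw0 : d * w != 0 by rewrite mulf_neq0.
have [l Tl] := ST s Ss.
(* Gauss's lemma for m, then for s, whose coefficient s`_l is a unit of D_T. *)
rewrite -coefCM; apply: (v_domain_gauss mT vT dw0) => k.
apply: (locdvd_unit mT (t := s`_l * t)); first by case: mT => _ _; apply.
rewrite -mulrA -coefCM.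
apply: (v_domain_gauss mT vT dw0) => e.
apply: (dvd_locdvd mT (y := n`_e)); rewrite -coefCM polyCM -sE.
by congr (nth 0 (polyseq _) e); ring.
Qed.

End Polynomials.

Theorem corollary5 (D : idomainType) :
  super_v_domain D <-> super_v_domain {poly D}.
Proof. split; [exact: super_v_domain_poly | exact: super_v_domain_polyW]. Qed.
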